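(* There exists a computably enumerable set $A\subseteq\mathbb{N}$ that is not regainingly approximable.
   Context: A real number $\alpha$ is regainingly approximable if there exists a computable nondecreasing sequence of rational numbers $(a_n)_n$ converging to $\alpha$ such that $\alpha-a_n<2^{-n}$ holds for infinitely many $n\in\mathbb{N}$. For $A\subseteq\mathbb{N}$ let $2^{-A}:=\sum_{a\in A}2^{-(a+1)}$. A set $A\subseteq\mathbb{N}$ is called regainingly approximable if it is computably enumerable and the real number $2^{-A}$ is regainingly approximable. *)

(* Defs.v *)
From Stdlib Require Cantor.
From mathcomp Require Import all_boot all_order all_algebra.
From mathcomp Require Import all_classical all_reals all_analysis.
Set Implicit Arguments.
Unset Strict Implicit.
Unset Printing Implicit Defensive.
Import Order.TTheory GRing.Theory Num.Theory.
Import numFieldNormedType.Exports.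
Local Open Scope classical_set_scope.
Local Open Scope ring_scope.

(* Model of computation: Kleene's partial recursive functions, presented (as
   in Lean's Nat.Partrec) with unary programs; several arguments are packed
   into one number by the Cantor pairing <a, n> := Cantor.to_nat (a, n). *)
Inductive code : Type :=
| CZero
| CSucc
| CFst
| CSnd
| CPair of code & code
| CComp of code & code
| CPrec of code & code
| CMu of code.

(* evaluates c x y : program c halts on input x with output y.
   CComp f g  computes  x |-> f (g x) ;
   CPrec f g  computes  <a, 0> |-> f a  and
                        <a, k + 1> |-> g <a, <k, value at <a, k>>> ;
   CMu f      computes  a |-> the least n with f <a, n> = 0, and halts only if
                        f is also defined at <a, m> for all m < n. *)
Fixpoint evaluates (c : code) (x y : nat) : Prop :=
  match c with
  | CZero => y = 0%N
  | CSucc => y = x.+1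
  | CFst => y = (Cantor.of_nat x).1
  | CSnd => y = (Cantor.of_nat x).2
  | CPair f g =>
      exists u v, [/\ evaluates f x u, evaluates g x v & y = Cantor.to_nat (u, v)]
  | CComp f g => exists2 u, evaluates g x u & evaluates f u y
  | CPrec f g =>
      let a := (Cantor.of_nat x).1 in
      (fix iterate (n z : nat) : Prop :=
         match n with
         | 0%N => evaluates f a z
         | k.+1 => exists2 w, iterate k w &
             evaluates g (Cantor.to_nat (a, Cantor.to_nat (k, w))) z
         end) (Cantor.of_nat x).2 y
  | CMu f =>
      evaluates f (Cantor.to_nat (x, y)) 0%N /\
      forall m, (m < y)%N -> exists v, evaluates f (Cantor.to_nat (x, m)) v.+1
  end.

Definition computable (f : nat -> nat) : Prop :=
  exists c, forall n, evaluates c n (f n).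

Definition computably_enumerable (A : set nat) : Prop :=
  exists c, A = [set n | exists y, evaluates c n y].

Definition computable_rat_seq (a : nat -> rat) : Prop :=
  exists s p q : nat -> nat,
    [/\ computable s, computable p, computable q &
        forall n, a n = (-1) ^+ s n * (p n)%:R / (q n).+1%:R].

Definition regainingly_approximable (R : realType) (alpha : R) : Prop :=
  exists a : nat -> rat,
    [/\ computable_rat_seq a,
        nondecreasing_seq a,
        (ratr (a n) : R) @[n --> \oo] --> alpha &
        infinite_set [set n | alpha - ratr (a n) < 2 ^- n]].

Definition two_pow_neg (R : realType) (A : set nat) : R :=
  limn (series (fun a : nat => \1_A a * 2 ^- a.+1 : R)).

Definition regainingly_approximable_set (R : realType) (A : set nat) : Prop :=
  computably_enumerable A /\ regainingly_approximable (two_pow_neg R A).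

(* Main.v *)
Require Import Defs.
From Stdlib Require Cantor.
From mathcomp Require Import all_boot all_order all_algebra.
From mathcomp Require Import all_classical all_reals all_analysis.
From mathcomp Require Import zify lra.

(* A = {2k + 1} u {2k | program number (fst k) outputs 0 on input k}. Let a be a
   computable nondecreasing rational sequence below alpha = 2^-A. The function
   sending k to the bit in position 2k of a(n') - rounded down strictly, with n'
   the index 2k' + 2 attached to the successor k' of k in its row - is computed
   by some program e. On row e the set A thus differs from that bit, so a(n') and
   alpha disagree at position 2k or earlier. The odd elements of A exclude a
   carry, whence alpha - a(m) >= alpha - a(n') >= 2^-(2k + 2) >= 2^-m whenever
   2k + 2 <= m <= n'. These intervals, for k along row e, cover all large m. *)

Set Implicit Arguments.
Unset Strict Implicit.
Unset Printing Implicit Defensive.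

(** * Pairing and closure properties of computable functions *)

Definition cpair (a b : nat) : nat := Cantor.to_nat (a, b).
Definition fst_of (x : nat) : nat := (Cantor.of_nat x).1.
Definition snd_of (x : nat) : nat := (Cantor.of_nat x).2.

Lemma fst_cpair a b : fst_of (cpair a b) = a.
Proof. by rewrite /fst_of /cpair Cantor.cancel_of_to. Qed.

Lemma snd_cpair a b : snd_of (cpair a b) = b.
Proof. by rewrite /snd_of /cpair Cantor.cancel_of_to. Qed.

Lemma leq_cpair_snd a b : b <= cpair a b.
Proof. have := Cantor.to_nat_non_decreasing a b; rewrite /cpair; lia. Qed.

Arguments Cantor.to_nat : simpl never.
Arguments Cantor.of_nat : simpl never.
Arguments cpair : simpl never.
Arguments fst_of : simpl never.
Arguments snd_of : simpl never.

Definition cpairE := (fst_cpair, snd_cpair).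

Lemma eq_computable f g : f =1 g -> computable f -> computable g.
Proof. by move=> /funext ->. Qed.

(** Cantor pairing is onto, so re-pairing the two projections restores the argument. *)
Lemma computable_id : computable id.
Proof.
exists (CPair CFst CSnd) => x; exists (fst_of x), (snd_of x).
by split => //; rewrite /fst_of /snd_of -surjective_pairing Cantor.cancel_to_of.
Qed.

Lemma computable_succ : computable succn.
Proof. by exists CSucc. Qed.

Lemma computable_fst : computable fst_of.
Proof. by exists CFst. Qed.

Lemma computable_snd : computable snd_of.
Proof. by exists CSnd. Qed.

Lemma computable_comp f g :
  computable f -> computable g -> computable (fun x => f (g x)).
Proof. by move=> [c cf] [d dg]; exists (CComp c d) => n; exists (g n). Qed.

Lemma computable_cpair f g :
  computable f -> computable g -> computable (fun x => cpair (f x) (g x)).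
Proof.
by move=> [c cf] [d dg]; exists (CPair c d) => n; exists (f n), (g n); split.
Qed.

Lemma computable_const k : computable (fun=> k).
Proof.
elim: k => [|k]; first by exists CZero.
exact: computable_comp computable_succ.
Qed.

Lemma computable_rec (b : nat -> nat) (r : nat -> nat -> nat -> nat) (n : nat -> nat) :
  computable b ->
  computable (fun z => r (fst_of z) (fst_of (snd_of z)) (snd_of (snd_of z))) ->
  computable n ->
  computable (fun x => nat_rec (fun=> nat) (b x) (r x) (n x)).
Proof.
move=> [c cb] [d dr] n_comp.
(* [CPrec] takes the parameter and the count as one pair, and its parameter is here the whole
   argument [x]. *)
suff rec_comp : computable (fun z =>
    nat_rec (fun=> nat) (b (fst_of z)) (r (fst_of z)) (snd_of z)).
  apply: eq_computable (computable_comp rec_comp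
    (computable_cpair computable_id n_comp)) => x.
  by rewrite !cpairE.
exists (CPrec c d) => z.
rewrite /= -/(fst_of z) -/(snd_of z).
elim: (snd_of z) => [|k IH]; first exact: cb.
set w := nat_rec _ _ _ k in IH *.
exists w => //.
by have := dr (cpair (fst_of z) (cpair k w)); rewrite !cpairE.
Qed.

Lemma computable_pred : computable predn.
Proof.
apply: eq_computable (computable_rec (r := fun _ k _ => k) (computable_const 0)
  (computable_comp computable_fst computable_snd) computable_id) => x.
by case: x.
Qed.

Lemma computable_if_eq0 t f g : computable t -> computable f -> computable g ->
  computable (fun x => if t x == 0 then f x else g x).
Proof.
move=> t_comp f_comp g_comp.
apply: eq_computable (computable_rec (r := fun x _ _ => g x) f_comp
  (computable_comp g_comp computable_fst) t_comp) => x.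
by case: (t x).
Qed.

Lemma computable_iter s b n : computable s -> computable b -> computable n ->
  computable (fun x => iter (n x) s (b x)).
Proof.
move=> s_comp b_comp n_comp.
apply: eq_computable (computable_rec (r := fun _ _ w => s w) b_comp
  (computable_comp s_comp (computable_comp computable_snd computable_snd))
  n_comp) => x.
by elim: (n x) => //= k ->.
Qed.

Lemma computable_add f g : computable f -> computable g ->
  computable (fun x => f x + g x).
Proof.
move=> f_comp g_comp.
apply: eq_computable (computable_iter computable_succ f_comp g_comp) => x.
by rewrite iter_succn.
Qed.

Lemma computable_sub f g : computable f -> computable g ->
  computable (fun x => f x - g x).
Proof.
move=> f_comp g_comp.
apply: eq_computable (computable_iter computable_pred f_comp g_comp) => x.
exact: iter_predn.
Qed.

Lemma computable_mul f g : computable f -> computable g ->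
  computable (fun x => f x * g x).
Proof.
move=> f_comp g_comp.
apply: eq_computable (computable_rec (r := fun x _ w => f x + w)
  (computable_const 0) (computable_add (computable_comp f_comp computable_fst)
  (computable_comp computable_snd computable_snd)) g_comp) => x.
by elim: (g x) => [|k /= ->]; rewrite ?muln0 ?mulnS.
Qed.

Lemma computable_exp2 f : computable f -> computable (fun x => 2 ^ f x).
Proof.
move=> f_comp.
apply: eq_computable (computable_iter (computable_mul (computable_const 2)
  computable_id) (computable_const 1) f_comp) => x.
by elim: (f x) => //= k ->; rewrite expnS.
Qed.

(** Parity flips under [w => 1 - w], iterated from 0. *)
Lemma computable_odd f : computable f -> computable (fun x => odd (f x) : nat).
Proof.
move=> f_comp.
apply: eq_computable (computable_iter (computable_sub (computable_const 1)
  computable_id) (computable_const 0) f_comp) => x.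
by elim: (f x) => //= k ->; case: (odd k).
Qed.

Lemma computable_if_eq t u f g :
  computable t -> computable u -> computable f -> computable g ->
  computable (fun x => if t x == u x then f x else g x).
Proof.
move=> t_comp u_comp f_comp g_comp.
apply: eq_computable (computable_if_eq0 (computable_add
  (computable_sub t_comp u_comp) (computable_sub u_comp t_comp)) f_comp g_comp)
  => x.
by rewrite addn_eq0 !subn_eq0 -eqn_leq.
Qed.

Lemma computable_mu f h : computable f ->
  (forall x, f (cpair x (h x)) = 0) ->
  (forall x m, m < h x -> 0 < f (cpair x m)) -> computable h.
Proof.
move=> [c cf] fh0 f_gt0; exists (CMu c) => x; split.
  by have := cf (cpair x (h x)); rewrite fh0.
move=> m /f_gt0 fm; exists (f (cpair x m)).-1.
by have := cf (cpair x m); rewrite prednK.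
Qed.

Lemma computable_div f g : computable f -> computable g ->
  computable (fun x => f x %/ (g x).+1).
Proof.
move=> f_comp g_comp.
(* The quotient is the least [m] with [f x < m.+1 * (g x).+1], that is, the least zero of [r] at
   [cpair x m]. *)
pose r z := (f (fst_of z)).+1 - (snd_of z).+1 * (g (fst_of z)).+1.
apply: (@computable_mu r) => [|x|x m].
- apply: computable_sub.
    exact: computable_comp computable_succ (computable_comp f_comp computable_fst).
  apply: computable_mul; first exact: computable_comp computable_succ computable_snd.
  exact: computable_comp computable_succ (computable_comp g_comp computable_fst).
- by rewrite /r !cpairE; apply/eqP; rewrite subn_eq0; exact: ltn_ceil.
- by rewrite /r !cpairE subn_gt0 ltnS leq_divRL.
Qed.

Lemma computable_nth fs t u : (forall i, computable (nth id fs i)) ->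
  computable t -> computable u -> computable (fun x => nth id fs (t x) (u x)).
Proof.
move=> + + u_comp; elim: fs t => [|f fs IH] t fs_comp t_comp.
  by apply: eq_computable u_comp => x; rewrite nth_nil.
apply: eq_computable (computable_if_eq0 t_comp
  (computable_comp (fs_comp 0) u_comp)
  (IH _ (fun i => fs_comp i.+1) (computable_comp computable_pred t_comp))) => x.
by case: (t x).
Qed.

(** * A deterministic stack machine running all programs *)

(* A machine state is [cpair v K], with a value [v] and a stack [K] of
   instructions still to be applied to it; [0] is the empty stack. An
   instruction [cpair t d] has tag [t] and data [d]. Tags 0 to 7 are the
   constructors of [code]; tags 8 to 11 resume a suspended computation. *)
Definition push (i k : nat) : nat := (cpair i k).+1.

(** Transitions receive [cpair v (cpair d K)]: [step] has popped the instruction and used its tag to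
    select the transition. *)
Definition operand (z : nat) : nat := fst_of z.
Definition payload (z : nat) : nat := fst_of (snd_of z).
Definition rest (z : nat) : nat := snd_of (snd_of z).

Fixpoint encode (c : Defs.code) : nat :=
  match c with
  | CZero => cpair 0 0
  | CSucc => cpair 1 0
  | CFst => cpair 2 0
  | CSnd => cpair 3 0
  | CPair f g => cpair 4 (cpair (encode f) (encode g))
  | CComp f g => cpair 5 (cpair (encode f) (encode g))
  | CPrec f g => cpair 6 (cpair (encode f) (encode g))
  | CMu f => cpair 7 (encode f)
  end.

Definition resume_pair (g x : nat) : nat := cpair 8 (cpair g x).
Definition finish_pair (u : nat) : nat := cpair 9 u.
(* [k] counts the iterations done and [r] those remaining. *)
Definition resume_prec (g a k r : nat) : nat :=
  cpair 10 (cpair g (cpair a (cpair k r))).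
Definition resume_mu (f x m : nat) : nat := cpair 11 (cpair f (cpair x m)).

Definition transitions : seq (nat -> nat) :=
  [:: (fun z => cpair 0 (rest z));
      (fun z => cpair (operand z).+1 (rest z));
      (fun z => cpair (fst_of (operand z)) (rest z));
      (fun z => cpair (snd_of (operand z)) (rest z));
      (fun z => cpair (operand z) (push (fst_of (payload z))
         (push (resume_pair (snd_of (payload z)) (operand z)) (rest z))));
      (fun z => cpair (operand z) (push (snd_of (payload z))
         (push (fst_of (payload z)) (rest z))));
      (fun z => cpair (fst_of (operand z)) (push (fst_of (payload z))
         (push (resume_prec (snd_of (payload z)) (fst_of (operand z)) 0
                  (snd_of (operand z))) (rest z))));
      (fun z => cpair (cpair (operand z) 0) (push (payload z)
         (push (resume_mu (payload z) (operand z) 0) (rest z))));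
      (fun z => cpair (snd_of (payload z)) (push (fst_of (payload z))
         (push (finish_pair (operand z)) (rest z))));
      (fun z => cpair (cpair (payload z) (operand z)) (rest z));
      (fun z => let g := fst_of (payload z) in
         let a := fst_of (snd_of (payload z)) in
         let k := fst_of (snd_of (snd_of (payload z))) in
         let r := snd_of (snd_of (snd_of (payload z))) in
         if r == 0 then cpair (operand z) (rest z)
         else cpair (cpair a (cpair k (operand z)))
                (push g (push (resume_prec g a k.+1 r.-1) (rest z))));
      (fun z => let f := fst_of (payload z) in
         let x := fst_of (snd_of (payload z)) in
         let m := snd_of (snd_of (payload z)) in
         if operand z == 0 then cpair m (rest z)
         else cpair (cpair x m.+1) (push f (push (resume_mu f x m.+1) (rest z))))].

(** Halted states are fixed points, so running past the halting time is harmless and halting becomes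
    a search over the number of steps of a total function. *)
Definition step (z : nat) : nat :=
  if snd_of z == 0 then z
  else let i := fst_of (snd_of z).-1 in
    nth id transitions (fst_of i)
      (cpair (fst_of z) (cpair (snd_of i) (snd_of (snd_of z).-1))).

Ltac computability := repeat first
  [ exact: computable_id | exact: computable_const
  | exact: computable_fst | exact: computable_snd
  | apply: computable_if_eq0 | apply: computable_cpair
  | apply: (computable_comp computable_succ)
  | apply: (computable_comp computable_pred)
  | apply: (computable_comp computable_fst)
  | apply: (computable_comp computable_snd) ].

Lemma computable_step : computable step.
Proof.
apply: computable_if_eq0; [by computability | by computability |].
apply: computable_nth; [|by computability..].
rewrite /transitions /operand /payload /rest /push.
do 12! [case=> [|]; first by rewrite /=; computability].
by move=> i; rewrite nth_default //; exact: computable_id.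
Qed.

Lemma step_push x t d K : step (cpair x (push (cpair t d) K)) =
  nth id transitions t (cpair x (cpair d K)).
Proof. by rewrite /step /push !cpairE. Qed.

Lemma step_halted y : step (cpair y 0) = cpair y 0.
Proof. by rewrite /step snd_cpair. Qed.

Definition reaches (z z' : nat) : Prop := exists t, iter t step z = z'.

Lemma reaches_refl z : reaches z z.
Proof. by exists 0. Qed.

Lemma reaches_step z z' : reaches (step z) z' -> reaches z z'.
Proof. by case=> t <-; exists t.+1; rewrite iterSr. Qed.

Lemma reaches_trans z1 z2 z3 : reaches z1 z2 -> reaches z2 z3 -> reaches z1 z3.
Proof. by move=> [t <-] [u <-]; exists (u + t); rewrite iterD. Qed.

(** The shorter run extends to the longer one without leaving its halted state. *)
Lemma reaches_halted_inj z y y' :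
  reaches z (cpair y 0) -> reaches z (cpair y' 0) -> y = y'.
Proof.
have halted t v : iter t step (cpair v 0) = cpair v 0.
  by elim: t => //= t ->; rewrite step_halted.
have cpair0_inj v v' : cpair v 0 = cpair v' 0 -> v = v'.
  by move=> /(congr1 fst_of); rewrite !fst_cpair.
move=> [t zt] [u zu]; case: (leqP t u) => [|/ltnW] /subnK tu.
- by apply: cpair0_inj; rewrite -zu -tu iterD zt halted.
- by apply: cpair0_inj; rewrite -zt -tu iterD zu halted.
Qed.

Ltac run_step :=
  apply: reaches_step; rewrite step_push;
  cbv beta iota zeta delta [nth transitions operand payload rest];
  rewrite ?cpairE /=.

(** The stack [K] is arbitrary because a subprogram runs on top of the work suspended by its
    caller. *)
Lemma evaluates_reaches c x y K :
  evaluates c x y -> reaches (cpair x (push (encode c) K)) (cpair y K).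
Proof.
elim: c x y K => [||||f IHf g IHg|f IHf g IHg|f IHf g IHg|f IHf] x y K.
- by move=> /= ->; run_step; exact: reaches_refl.
- by move=> /= ->; run_step; exact: reaches_refl.
- by move=> /= ->; run_step; exact: reaches_refl.
- by move=> /= ->; run_step; exact: reaches_refl.
- move=> /= [u [v [fu gv ->]]]; run_step.
  apply: reaches_trans (IHf _ _ _ fu) _; run_step.
  by apply: reaches_trans (IHg _ _ _ gv) _; run_step; exact: reaches_refl.
- move=> /= [u gu fu]; run_step.
  by apply: reaches_trans (IHg _ _ _ gu) _; exact: IHf.
- move=> /= cxy; run_step; move: cxy.
  set iterate := (X in X _ y); rewrite -/(fst_of x) -/(snd_of x) in iterate *.
  set a := fst_of x in iterate *.
  (* Quantifying over [r] lets the induction on [k] turn a remaining iteration into a completed one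
     while [k + r], hence the initial state, stays fixed. *)
  have loop k r w : iterate k w ->
      reaches
        (cpair a (push (encode f) (push (resume_prec (encode g) a 0 (k + r)) K)))
        (cpair w (push (resume_prec (encode g) a k r) K)).
    elim: k r w => [|k IH] r w; first exact: IHf.
    move=> /= [v kv gv]; rewrite addSnnS; apply: reaches_trans (IH r.+1 v kv) _.
    by run_step; exact: IHg.
  move=> /(loop _ 0); rewrite addn0 => loop_y.
  by apply: reaches_trans loop_y _; run_step; exact: reaches_refl.
- move=> /= [fy0 f_pos]; run_step.
  (* Loop invariant: every candidate below [m] has been tested and gave a nonzero value. *)
  have loop m : m <= y ->
      reaches (cpair (cpair x 0) (push (encode f) (push (resume_mu (encode f) x 0) K)))
        (cpair (cpair x m) (push (encode f) (push (resume_mu (encode f) x m) K))).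
    elim: m => [_|m IH my]; first exact: reaches_refl.
    apply: reaches_trans (IH (ltnW my)) _; have [v fv] := f_pos m my.
    by apply: reaches_trans (IHf _ _ _ fv) _; run_step; exact: reaches_refl.
  apply: reaches_trans (loop y (leqnn y)) _.
  by apply: reaches_trans (IHf _ _ _ fy0) _; run_step; exact: reaches_refl.
Qed.

(** Both evaluations are runs from the same initial state, so determinism of the machine settles all
    constructors at once. *)
Lemma evaluates_inj c x y y' : evaluates c x y -> evaluates c x y' -> y = y'.
Proof.
move=> /(evaluates_reaches 0) xy /(evaluates_reaches 0).
exact: reaches_halted_inj xy.
Qed.

(** As [g] is total, the unbounded search for a zero halts exactly when there is one. *)
Lemma computably_enumerable_zero g : computable g ->
  computably_enumerable [set x | exists t, g (cpair x t) = 0]%classic.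
Proof.
move=> [c cg]; exists (CMu c); apply/seteqP; split=> x /= [t].
  move=> gxt0.
  have ex0 : exists t, g (cpair x t) == 0 by exists t; rewrite gxt0.
  case: (ex_minnP ex0) => m /eqP gm0 m_min; exists m; split.
    by have := cg (cpair x m); rewrite gm0.
  move=> k km; exists (g (cpair x k)).-1.
  rewrite prednK; first exact: cg.
  by rewrite lt0n; apply: contraTN km => /m_min; rewrite -leqNgt.
move=> [cxt _]; exists t; exact: evaluates_inj (cg _) cxt.
Qed.

(** * The diagonal set and its enumeration *)

Definition run (t k : nat) : nat :=
  iter t step (cpair k (push (fst_of k) 0)).

(* [cpair 0 0] reduces to [0]. *)
Definition diagonal (k : nat) : Prop := exists t, run t k = cpair 0 0.

(** A single program is diagonalized against on its whole row of inputs [cpair (encode c) i], so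
    that the disagreement recurs at infinitely many positions. *)
Lemma diagonalP c f i (k := cpair (encode c) i) :
  (forall x, evaluates c x (f x)) -> diagonal k <-> f k = 0.
Proof.
move=> cf; have fk : reaches (cpair k (push (fst_of k) 0)) (cpair (f k) 0).
  by rewrite /k fst_cpair; exact: evaluates_reaches.
split=> [k0|fk0]; first exact: reaches_halted_inj fk k0.
by rewrite fk0 in fk.
Qed.

(* The odd numbers keep the tails of [2^-A] large. *)
Definition diagonal_set : set nat :=
  [set x | exists k, x = k.*2.+1 \/ x = k.*2 /\ diagonal k]%classic.

Lemma diagonal_set_odd k : diagonal_set k.*2.+1.
Proof. by exists k; left. Qed.

Lemma diagonal_set_even k : diagonal_set k.*2 <-> diagonal k.
Proof.
split=> [[l [|[]]]|]; last by exists k; right.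
- by move=> /(congr1 odd); rewrite /= !odd_double.
- by move=> /double_inj ->.
Qed.

Lemma diagonal_set_ce : computably_enumerable diagonal_set.
Proof.
pose k w := fst_of (snd_of w); pose t w := snd_of (snd_of w).
(* A search witness packs a candidate [k] with a running time [t]; since [cpair 0 0] is 0, [run]
   itself serves as the test. *)
pose g w := if fst_of w == (k w + k w).+1 then 0
            else if fst_of w == k w + k w then run (t w) (k w) else 1.
have k_comp : computable k by computability.
have kk_comp := computable_add k_comp k_comp.
have g_comp : computable g.
  apply: computable_if_eq; first by computability.
  - exact: (computable_comp computable_succ kk_comp).
  - exact: computable_const.
  apply: computable_if_eq; [by computability|by []| |exact: computable_const].
  by apply: computable_iter; [exact: computable_step|rewrite /k /push; computability..].
have := computably_enumerable_zero g_comp; congr (computably_enumerable _).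
apply/seteqP; split=> x /=.
  move=> [w]; rewrite /g /k !cpairE addnn.
  case: eqP => [-> _|_]; first exact: diagonal_set_odd.
  case: eqP => [-> run0|//].
  by apply/diagonal_set_even; exists (t (cpair (fst_of w).*2 w)).
move=> [l [->|[-> [u run0]]]].
  by exists (cpair l 0); rewrite /g /k !cpairE addnn eqxx.
exists (cpair l u); rewrite /g /k /t !cpairE addnn eqxx run0.
by case: eqP.
Qed.

(** * Finite binary prefixes of [2^-A] *)

(** This is [2^n] times the [n]-th partial sum, with position 0 as leading digit; the parity of the
    value at [n.+1] is the membership of [n]. *)
Fixpoint prefix_value (A : set nat) (n : nat) : nat :=
  if n is m.+1 then (prefix_value A m).*2 + (m \in A) else 0.

Section TwoPowNeg.
Import Order.TTheory GRing.Theory Num.Theory.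
Import numFieldNormedType.Exports.
Local Open Scope classical_set_scope.
Local Open Scope ring_scope.
Variables (R : realType) (A : set nat).

Let partial n : R := (prefix_value A n)%:R / 2 ^+ n.

Lemma series_prefix_value :
  series (fun a : nat => \1_A a * 2 ^- a.+1 : R) = partial.
Proof.
apply/funext; elim=> [|n IH]; first by rewrite /series /= big_geq // /partial mul0r.
rewrite seriesSr IH /partial /= indicE natrD -mul2n natrM exprS.
rewrite [RHS]mulrDl; congr (_ + _).
by rewrite invfM mulrACA divff ?mul1r // pnatr_eq0.
Qed.

(** Each new term is 0 or [2^-(n+1)], so [partial n] is nondecreasing and [partial n + 2^-n]
    nonincreasing; the limit lies between them. *)
Lemma two_pow_neg_bounds n :
  (prefix_value A n)%:R / 2 ^+ n <= two_pow_neg R A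
    <= (prefix_value A n).+1%:R / 2 ^+ n.
Proof.
have le_partial m k : partial m <= partial (m + k) /\
    partial (m + k) + 2 ^- (m + k) <= partial m + 2 ^- m.
  elim: k => [|k [IH1 IH2]]; first by rewrite addn0.
  rewrite addnS; set j := (m + k)%N in IH1 IH2 *.
  have -> : partial j.+1 = partial j + (j \in A)%:R * 2 ^- j.+1.
    by rewrite -series_prefix_value seriesSr indicE.
  have half : 2 ^- j.+1 + 2 ^- j.+1 = 2 ^- j :> R.
    by rewrite -mulr2n exprS invfM -mulrnAl -[2^-1 *+ 2]mulr_natr mulVf ?mul1r // pnatr_eq0.
  have pos : 0 < 2 ^- j.+1 :> R by rewrite invr_gt0 exprn_gt0.
  move: (2 ^- j.+1) (2 ^- j) half pos IH2 => u v half u_gt0 IH2.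
  by case: (j \in A); rewrite ?mul1r ?mul0r; split; lra.
have nd : nondecreasing_seq partial.
  by move=> m k /subnKC <-; case: (le_partial m (k - m)%N).
have ub m k : partial k <= partial m + 2 ^- m.
  have [mk|/ltnW km] := leqP m k.
    have [_] := le_partial m (k - m)%N; rewrite subnKC //.
    by apply: le_trans; rewrite lerDl invr_ge0 exprn_ge0.
  by apply: le_trans (nd _ _ km) _; rewrite lerDl invr_ge0 exprn_ge0.
have cvg_partial : cvgn partial.
  apply: nondecreasing_is_cvgn => //; exists (partial 0 + 2 ^- 0) => _ [k _ <-].
  exact: ub.
rewrite /two_pow_neg series_prefix_value; apply/andP; split.
  exact: nondecreasing_cvgn_le.
apply: limr_le => //; apply: nearW => k.
by rewrite -natr1 mulrDl mul1r; exact: ub.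
Qed.

End TwoPowNeg.

(** * A gap below [2^-A] from one differing digit *)

Section Separation.
Import Order.TTheory GRing.Theory Num.Theory.
Local Open Scope ring_scope.
Variables (R : realType) (A : set nat).

(* Here [m = ceil (2^n * (p / (q + 1))) - 1]. As [p / (q + 1) <= 2^-A], it is at
   most [prefix_value A n], hence smaller since the parities differ; and [n \in A]
   contributes the extra [2^-(n+1)]. *)
Lemma separation_of_parity (n p q : nat) (m := ((2 ^ n * p).-1 %/ q.+1)%N) :
  (0 < p)%N -> n \in A -> odd m != odd (prefix_value A n) ->
  p%:R / q.+1%:R <= two_pow_neg R A ->
  p%:R / q.+1%:R + 2 ^- n.+1 <= two_pow_neg R A.
Proof.
move=> p_gt0 nA parity aA.
have N_gt0 : (0 < 2 ^ n * p)%N by rewrite muln_gt0 expn_gt0.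
have scale (u : nat) : (p%:R / q.+1%:R <= u%:R / 2 ^+ n :> R) =
    (2 ^ n * p <= u * q.+1)%N.
  rewrite ler_pdivrMr ?ltr0Sn // mulrAC ler_pdivlMr ?exprn_gt0 //.
  by rewrite -natrX -!natrM ler_nat mulnC.
(* By strict rounding, [m < u] is equivalent to [p / (q + 1) <= u / 2^n]; this is used from right to
   left here and from left to right in [le_a]. *)
have le_m : (m <= prefix_value A n)%N.
  have /andP[_] := two_pow_neg_bounds R A n.
  move=> /(le_trans aA); rewrite scale => le_N.
  rewrite -ltnS /m ltn_divLR //; apply: leq_trans le_N.
  by rewrite prednK.
have lt_m : (m < prefix_value A n)%N.
  by rewrite ltn_neqAle le_m andbT; apply: contraNN parity => /eqP ->.
have le_a : p%:R / q.+1%:R <= (prefix_value A n)%:R / 2 ^+ n :> R.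
  rewrite scale -(prednK N_gt0).
  exact: leq_trans (ltn_ceil _ (ltn0Sn q)) (leq_mul lt_m (leqnn _)).
have /andP[le_alpha _] := two_pow_neg_bounds R A n.+1.
apply: le_trans (lerD le_a (lexx _)) (le_trans _ le_alpha).
rewrite /= nA natrD [leRHS]mulrDl mul1r lerD2r -mul2n natrM exprS invfM.
by rewrite mulrACA divff ?mul1r // pnatr_eq0.
Qed.

End Separation.

(** * The diagonal argument *)

Lemma ex_between (g : nat -> nat) m : (forall i, i <= g i) -> g 0 <= m ->
  exists i, g i <= m < g i.+1.
Proof.
move=> g_ge g0m.
(* The largest [i] with [g i <= m] exists because [i <= g i] bounds it by [m]. *)
have [|i gim i_max] := @ex_maxnP (fun i => g i <= m) m (ex_intro _ 0 g0m).
  by move=> i; apply: leq_trans (g_ge i).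
by exists i; rewrite gim /= ltnNge; apply/negP => /i_max; rewrite ltnn.
Qed.

Section Main.
Import Order.TTheory GRing.Theory Num.Theory.
Import numFieldNormedType.Exports.
Local Open Scope classical_set_scope.
Local Open Scope ring_scope.

Lemma two_pow_neg_diagonal_set (R : realType) :
  ~ regainingly_approximable (two_pow_neg R diagonal_set).
Proof.
set alpha := two_pow_neg R diagonal_set.
move=> [a [[s [p [q [_ p_comp q_comp aE]]]] a_nd a_cvg a_inf]].
have a_le n : ratr (a n) <= alpha.
  rewrite -(cvg_lim (@Rhausdorff R) a_cvg).
  apply: (@nondecreasing_cvgn_le _ (fun n => ratr (a n))).
    by move=> i j ij; rewrite ler_rat a_nd.
  by apply/cvg_ex; exists alpha.
pose next k := (cpair (fst_of k) (snd_of k).+1).*2.+2%N.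
(* Position [2k] is the last of the first [2k + 1] digits, so its bit is the parity of [digit k].
   Only the absolute value of the term enters; nonpositive terms are treated separately below. *)
pose digit k := ((2 ^ k.*2.+1 * p (next k)).-1 %/ (q (next k)).+1)%N.
have [c c_digit] : computable (fun k => odd (digit k) : nat).
  have dbl f : computable f -> computable (fun k => (f k).*2).
    move=> f_comp; apply: eq_computable (computable_add f_comp f_comp) => k.
    by rewrite addnn.
  have next_comp : computable next.
    apply: (computable_comp computable_succ).
    by apply: (computable_comp computable_succ); apply: dbl; computability.
  apply: computable_odd; apply: computable_div;
    last exact: computable_comp q_comp next_comp.
  apply: (computable_comp computable_pred); apply: computable_mul.
    apply: computable_exp2; apply: (computable_comp computable_succ).
    by apply: dbl; exact: computable_id.
  exact: computable_comp p_comp next_comp.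
(* Consecutive values of [pos] delimit the indices at which the [i]-th entry of the row of [c]
   forces a large gap. *)
pose pos i := (cpair (encode c) i).*2.+2%N.
have [m [m_close pos0_m]] : exists m, alpha - ratr (a m) < 2 ^- m /\ (pos 0 <= m)%N.
  apply: contrapT => none; apply: a_inf.
  apply: sub_finite_set (finite_II (pos 0)) => m /= m_close.
  by rewrite ltnNge; apply/negP => pos_m; apply: none; exists m.
have pos_ge i : (i <= pos i)%N by have := leq_cpair_snd (encode c) i; rewrite /pos; lia.
have [i /andP[pos_i m_pos]] := ex_between pos_ge pos0_m.
pose k := cpair (encode c) i.
have nextE : next k = pos i.+1 by rewrite /next /k !cpairE.
(* Since [k.*2.+2 = pos i <= m < next k], monotonicity carries this gap back to [m], where it is at
   least [2^-m] and contradicts [m_close]. *)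
suff : ratr (a (next k)) + 2 ^- k.*2.+2 <= alpha.
  have : ratr (a m) <= ratr (a (next k)) :> R.
    by rewrite ler_rat a_nd // nextE ltnW.
  have : 2 ^- m <= 2 ^- k.*2.+2 :> R.
    by rewrite lef_pV2 ?posrE ?exprn_gt0 // ler_weXn2l // ler1n.
  by move: m_close; lra.
have odd_mem : k.*2.+1 \in diagonal_set by apply/mem_set/diagonal_set_odd.
(* The prefix has the parity of the membership of [k.*2], which by [diagonalP] holds exactly when
   [digit k] is even. *)
have parity : odd (digit k) != odd (prefix_value diagonal_set k.*2.+1).
  rewrite /= oddD odd_double oddb /=.
  have : diagonal_set k.*2 <-> odd (digit k) = 0%N :> nat.
    exact: iff_trans (diagonal_set_even k) (diagonalP i c_digit).
  case: (odd (digit k)) => -[kA Ak].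
    by apply/negP => /eqP /esym /set_mem /kA.
  by rewrite (mem_set (Ak _)).
(* The element [k.*2.+1] alone contributes this much, which settles the case of a nonpositive
   term. *)
have alpha_ge : 2 ^- k.*2.+2 <= alpha.
  have /andP[+ _] := two_pow_neg_bounds R diagonal_set k.*2.+2.
  apply: le_trans; rewrite ler_peMl ?invr_ge0 ?exprn_ge0 //.
  by rewrite ler1n /= odd_mem addn1.
have aE' : ratr (a (next k)) =
    (-1) ^+ s (next k) * ((p (next k))%:R / (q (next k)).+1%:R) :> R.
  rewrite aE fmorph_div rmorphM /= rmorphXn rmorphN1 !ratr_nat mulrA //.
have [a_le0|a_gt0] := leP (ratr (a (next k)) : R) 0.
  by rewrite -[leRHS]add0r lerD.
have abs_ge0 : 0 <= (p (next k))%:R / (q (next k)).+1%:R :> R by rewrite divr_ge0.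
have even_s : ~~ odd (s (next k)).
  apply/negP => odd_s; move: a_gt0.
  by rewrite aE' -signr_odd odd_s expr1 mulN1r oppr_gt0 ltNge abs_ge0.
have a_frac : ratr (a (next k)) = (p (next k))%:R / (q (next k)).+1%:R :> R.
  by rewrite aE' -signr_odd (negPf even_s) expr0 mul1r.
rewrite a_frac; apply: separation_of_parity => //; last by rewrite -a_frac.
by rewrite lt0n; apply: contraTN a_gt0 => /eqP p0; rewrite a_frac p0 mul0r ltxx.
Qed.

End Main.

Theorem theorem5p3 (R : realType) :
  exists A : set nat,
    computably_enumerable A /\ ~ regainingly_approximable_set R A.
Proof.
exists diagonal_set; split; first exact: diagonal_set_ce.
by move=> [_]; exact: two_pow_neg_diagonal_set.
Qed.
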